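(* Let $S,T$ be disjoint finite sets, $\ell\le|T|$ an integer, $f_V=(f_S,f_T)$, $g_V=(g_S,g_T)$ integer-valued functions on $V=S\cup T$ with $0\le f_V\le g_V$, and let $\alpha\le\beta$ be non-negative integers. Suppose there is a simple bipartite graph with matching number at least $\ell$ whose degrees satisfy $f_V\le d\le g_V$ (equivalently, $\widetilde f_T(Y)-|X||Y|+(\ell-|X|-|Y|)^+\le\widetilde g_S(S-X)$ and $\widetilde f_S(X)-|X||Y|+(\ell-|X|-|Y|)^+\le\widetilde g_T(T-Y)$ for all $X\subseteq S$, $Y\subseteq T$). Then there is a simple bipartite graph $G=(S,T;E)$ with $\nu(G)\ge\ell$ and $f_V(v)\le d_G(v)\le g_V(v)$ for all $v\in V$: (A) with $\alpha\le|E|$ if and only if $$\widetilde g_S(S-X)+\widetilde g_T(T-Y)+|X||Y|-(\ell-|X|-|Y|)^+\ge\alpha\quad\text{whenever }X\subseteq S,\ Y\subseteq T;\quad(1)$$ moreover, (1) holds if it is required only when $X$ consists of $i$ elements of $S$ with the largest values of $g_S$ and $Y$ consists of $j$ elements of $T$ with the largest values of $g_T$ $(i=0,\dots,|S|,\ j=0,\dots,|T|)$; (B) with $|E|\le\beta$ if and only if $$\widetilde f_S(X)+\widetilde f_T(Y)-|X||Y|+(\ell-|X|-|Y|)^+\le\beta\quad\text{whenever }X\subseteq S,\ Y\subseteq T;\quad(2)$$ moreover, (2) holds if it is required only when $X$ consists of $i$ elements of $S$ with the largest values of $f_S$ and $Y$ consists of $j$ elements of $T$ with the largest values of $f_T$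 $(i=0,\dots,|S|,\ j=0,\dots,|T|)$; (AB) with $\alpha\le|E|\le\beta$ if and only if both (1) and (2) hold.
   Context: A bipartite graph is simple if it has no parallel edges; $\nu(G)$ is the maximum size of a matching; $d_G(v)$ is the degree. $\widetilde h(X)=\sum_{v\in X}h(v)$; $x^+=\max\{x,0\}$. *)

(* Defs.v *)
From HB Require Import structures.
From mathcomp Require Import all_boot all_order all_algebra.
Set Implicit Arguments.
Unset Strict Implicit.
Unset Printing Implicit Defensive.
Import Order.TTheory GRing.Theory Num.Theory.
Local Open Scope ring_scope.

(* A simple bipartite graph G = (S,T;E) is given by its edge set, a subset of
   S * T: the types S and T are the two (automatically disjoint) colour classes
   and parallel edges are impossible. *)
Section Bipartite.

Variables S T : finType.
Implicit Types (E M : {set S * T}) (X : {set S}) (Y : {set T}).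

Definition degS E (s : S) : nat := #|[set e in E | e.1 == s]|.
Definition degT E (t : T) : nat := #|[set e in E | e.2 == t]|.

Definition matching E M : bool :=
  (M \subset E) &&
  [forall e1 in M, forall e2 in M,
     (e1 != e2) ==> (e1.1 != e2.1) && (e1.2 != e2.2)].

Definition matching_number E : nat :=
  (\max_(M : {set S * T} | matching E M) #|M|)%N.

Definition admissible (l : int) (fS gS : S -> int) (fT gT : T -> int) E : Prop :=
  [/\ l <= (matching_number E)%:Z,
      forall s : S, fS s <= (degS E s)%:Z <= gS s
    & forall t : T, fT t <= (degT E t)%:Z <= gT t].

End Bipartite.

Definition wsum (V : finType) (h : V -> int) (X : {set V}) : int :=
  \sum_(v in X) h v.

Definition pospart (x : int) : int := Num.max x 0.

(* X consists of #|X| elements with the largest values of h; ties may be broken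
   in any way. *)
Definition top_set (V : finType) (h : V -> int) (X : {set V}) : Prop :=
  forall x y : V, x \in X -> y \notin X -> h y <= h x.

Definition lower_edge_cond (S T : finType) (l : int) (gS : S -> int)
    (gT : T -> int) (alpha : int) (X : {set S}) (Y : {set T}) : bool :=
  wsum gS (~: X) + wsum gT (~: Y) + #|X|%:Z * #|Y|%:Z
    - pospart (l - #|X|%:Z - #|Y|%:Z) >= alpha.

Definition upper_edge_cond (S T : finType) (l : int) (fS : S -> int)
    (fT : T -> int) (beta : int) (X : {set S}) (Y : {set T}) : bool :=
  wsum fS X + wsum fT Y - #|X|%:Z * #|Y|%:Z
    + pospart (l - #|X|%:Z - #|Y|%:Z) <= beta.

(* Main.v *)
Require Import Defs.
From HB Require Import structures.
From mathcomp Require Import all_boot all_order all_algebra zify.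
Set Implicit Arguments.
Unset Strict Implicit.
Unset Printing Implicit Defensive.
Import Order.TTheory GRing.Theory Num.Theory.
Local Open Scope ring_scope.

(* The pairs (mS, mT) of degree sequences of simple bipartite graphs with
   nu >= l are the integral points x = (mS, -mT) on S + T with x(S + T) = 0 and
   x(Z) >= q(Z) for all Z, where, with X := S - Z and Y := Z :&: T,
   q(Z) = (l - |X| - |Y|)^+ - |X| |Y|, and q is supermodular.  Hence tight sets
   are closed under union and intersection: lowering coordinates, or moving one
   unit from T to S (or back), inside the box given by f and g can get stuck
   only at a set violating the feasibility condition, (1) or (2).
   To realize (mS, mT), decrease by one the l largest entries on each side: the
   reduced pair still satisfies the Gale-Ryser condition, so both pairs are
   realizable, and switches make one realization contain the other (Kundu); the
   difference is a matching of size l. *)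

(** * Integral boxed covers of a supermodular function *)

Section Wsum.
Variable V : finType.
Implicit Types (h x : V -> int) (A B X : {set V}).

Lemma wsumUI h A B : wsum h A + wsum h B = wsum h (A :|: B) + wsum h (A :&: B).
Proof.
have E Z : wsum h Z = \sum_v (if v \in Z then h v else 0).
  by rewrite /wsum big_mkcond.
rewrite !E -!big_split /=; apply: eq_bigr => v _.
by rewrite !inE; case: (v \in A); case: (v \in B); rewrite ?addr0 ?add0r.
Qed.

Lemma wsumID h A B : wsum h A = wsum h (A :&: B) + wsum h (A :\: B).
Proof. by rewrite /wsum (big_setID B). Qed.

Lemma wsumC h A : wsum h setT = wsum h A + wsum h (~: A).
Proof. by rewrite (wsumID h setT A) setTI setTD. Qed.

Lemma wsum0 h : wsum h set0 = 0.
Proof. by rewrite /wsum big_set0. Qed.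

Lemma wsum1 h v : wsum h [set v] = h v.
Proof. by rewrite /wsum big_set1. Qed.

Lemma wsumD h1 h2 A : wsum (fun v => h1 v + h2 v) A = wsum h1 A + wsum h2 A.
Proof. by rewrite /wsum big_split. Qed.

Lemma wsumB h1 h2 A : wsum (fun v => h1 v - h2 v) A = wsum h1 A - wsum h2 A.
Proof. by rewrite /wsum sumrB. Qed.

Lemma le_wsum h1 h2 A : {in A, forall v, h1 v <= h2 v} -> wsum h1 A <= wsum h2 A.
Proof. by move=> le_h; apply: ler_sum. Qed.

Lemma eq_wsum h1 h2 A : {in A, h1 =1 h2} -> wsum h1 A = wsum h2 A.
Proof. by move=> eq_h; apply: eq_bigr. Qed.

Lemma wsum_cst (c : int) A : wsum (fun=> c) A = #|A|%:Z * c.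
Proof. by rewrite /wsum sumr_const -mulr_natl natz. Qed.

Lemma wsum_mem A B : wsum (fun v => (v \in B : nat)%:Z) A = #|A :&: B|%:Z.
Proof.
rewrite -[RHS]mulr1 -(wsum_cst 1) /wsum [RHS](eq_bigl (mem (A :&: B))) //.
rewrite [in RHS](eq_bigl (fun v => (v \in A) && (v \in B))); last first.
  by move=> v; rewrite -in_setI.
by rewrite [RHS]big_mkcondr; apply: eq_bigr => v _; case: (v \in B).
Qed.

Lemma wsum_pred1 v A : wsum (fun w => (w == v : nat)%:Z) A = (v \in A)%:Z.
Proof.
have := wsum_mem A [set v]; rewrite (@eq_wsum _ (fun w => (w == v : nat)%:Z)).
  move=> ->; case vA: (v \in A); first by rewrite (setIidPr _) ?sub1set ?cards1.
  apply/eqP; rewrite eqz_nat cards_eq0 setI_eq0 disjoint_sym disjoints1.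
  by rewrite vA.
by move=> w _; rewrite inE.
Qed.

End Wsum.

Section Supermodular.
Variables (V : finType) (q : {set V} -> int).
Implicit Types (x : V -> int) (A B W Z D N : {set V}).

Definition supermodular := forall A B, q A + q B <= q (A :|: B) + q (A :&: B).

Definition covers x := forall Z, q Z <= wsum x Z.

Definition tight x Z := wsum x Z == q Z.

Hypotheses (q_super : supermodular) (q0 : q set0 = 0) (qT : q setT = 0).

Lemma tight_UI x A B : covers x -> tight x A -> tight x B ->
  tight x (A :|: B) /\ tight x (A :&: B).
Proof.
move=> cov /eqP tA /eqP tB; have := q_super A B; have := wsumUI x A B.
have := cov (A :|: B); have := cov (A :&: B); rewrite /tight; lia.
Qed.

Lemma tight0 x : tight x set0.
Proof. by rewrite /tight wsum0 q0. Qed.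

(** Uncrossing: the intersection of all tight sets through a given [d] is tight, and it avoids [N]
    because each [n] is missed by some tight set through [d]. [W] is the union of these
    intersections over [D]. *)
Lemma tight_separation x D N : covers x -> tight x setT ->
    (forall d n, d \in D -> n \in N -> exists Z, [&& tight x Z, d \in Z & n \notin Z]) ->
  exists W, [/\ tight x W, D \subset W & [disjoint W & N]].
Proof.
move=> cov tT sep.
exists (\bigcup_(d in D) \bigcap_(Z : {set V} | tight x Z && (d \in Z)) Z); split.
- apply: (big_ind (fun Z => tight x Z)); first exact: tight0.
    by move=> A B tA tB; have [] := tight_UI cov tA tB.
  move=> d _; apply: (big_ind (fun Z => tight x Z)) => //.
    by move=> A B tA tB; have [] := tight_UI cov tA tB.
  by move=> Z /andP[].
- apply/subsetP=> d dD; apply/bigcupP; exists d => //.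
  by apply/bigcapP=> Z /andP[].
- rewrite disjoint_sym; apply/pred0P=> n /=; apply/negbTE/negP=> /andP[nN].
  case/bigcupP=> d dD /bigcapP nW; have [Z /and3P[tZ dZ]] := sep _ _ dD nN.
  by rewrite nW ?tZ.
Qed.

Variables lo up : V -> int.
Hypothesis lo_up : forall v, lo v <= up v.

Definition boxed x := forall v, lo v <= x v <= up v.

(** Start from [up] and lower coordinates greedily. When stuck, the union [W] of all tight sets is
    tight and [x = lo] outside it, so the total is [q W + wsum lo (~: W) <= 0]. *)
Lemma boxed_cover_exists :
    (forall W, q W <= wsum up W) -> (forall W, q W + wsum lo (~: W) <= 0) ->
  exists x, [/\ boxed x, covers x & wsum x setT = 0].
Proof.
move=> q_up q_lo.
suff main n : forall x, boxed x -> covers x -> wsum x setT <= n%:Z ->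
    exists y, [/\ boxed y, covers y & wsum y setT = 0].
  apply: (main `|wsum up setT|%N up) => //; last by lia.
  by move=> v; rewrite lo_up lexx.
elim: n => [|n IHn] x box cov le_n.
  by exists x; split=> //; have := cov setT; lia.
have [v /andP[lo_v free_v]|stuck] :=
    pickP [pred v | (lo v < x v) && [forall Z : {set V}, tight x Z ==> (v \notin Z)]].
  pose y w := x w - (w == v : nat)%:Z.
  have yE Z : wsum y Z = wsum x Z - (v \in Z)%:Z by rewrite wsumB wsum_pred1.
  apply: (IHn y).
  - by move=> w; have := box w; rewrite /y; case: eqP => [->|_] /=; lia.
  - move=> Z; rewrite yE; have := cov Z.
    by have := forallP free_v Z; rewrite /tight; case: (v \in Z) => /=; lia.
  - by rewrite yE inE; lia.
exists x; split=> //.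
pose W := \bigcup_(Z : {set V} | tight x Z) Z.
have /eqP tW : tight x W.
  apply: (big_ind (fun Z => tight x Z)) => //; first exact: tight0.
  by move=> A B tA tB; have [] := tight_UI cov tA tB.
have loW : wsum x (~: W) = wsum lo (~: W).
  apply: eq_wsum => v; rewrite inE => vW; apply/eqP; have := stuck v => /=.
  have -> : [forall Z : {set V}, tight x Z ==> (v \notin Z)].
    apply/forallP=> Z; apply/implyP=> tZ; apply: contra vW => vZ.
    by apply/bigcupP; exists Z.
  by have := box v; lia.
by have := q_lo W; have := cov setT; rewrite (wsumC x W) loW tW; lia.
Qed.

(** Either a unit moves from some [t] outside [B] to some [s] in [B], or each such move is blocked
    by a tight set containing [t] but not [s]; separation then gives a tight [W] with [x = up] on
    [B :&: W] and [x = lo] off [B :|: W]. *)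
Lemma exchange_step x B : boxed x -> covers x -> wsum x setT = 0 ->
  (exists y, [/\ boxed y, covers y, wsum y setT = 0 & wsum y B = wsum x B + 1]) \/
  (exists W, wsum x B = wsum up (B :&: W) - wsum lo (~: (B :|: W)) - q W).
Proof.
move=> box cov xT.
have [[s t] /= /and5P[sB tB s_up t_lo free]|stuck] := pickP [pred p : V * V |
   [&& p.1 \in B, p.2 \notin B, x p.1 < up p.1, lo p.2 < x p.2 &
     [forall Z : {set V}, tight x Z ==> (p.2 \in Z) ==> (p.1 \in Z)]]].
  left; pose y w := x w + (w == s : nat)%:Z - (w == t : nat)%:Z.
  have yE Z : wsum y Z = wsum x Z + (s \in Z)%:Z - (t \in Z)%:Z.
    by rewrite wsumB wsumD !wsum_pred1.
  exists y; split; rewrite ?yE ?inE ?xT ?sB ?(negbTE tB) //=; last by lia.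
    move=> w; have := box w; rewrite /y.
    by case: (eqVneq w s) => [->|_]; case: eqVneq => [->|_]; lia.
  move=> Z; rewrite yE; have := cov Z; have := forallP free Z; rewrite /tight.
  by case: (s \in Z); case: (t \in Z) => /=; lia.
right; have [||W [/eqP tW DW WN]] := @tight_separation x
    [set t | (t \notin B) && (lo t < x t)] [set s | (s \in B) && (x s < up s)] cov.
- by rewrite /tight xT qT.
- move=> t s; rewrite !inE => /andP[tB t_lo] /andP[sB s_up].
  have /negbT := stuck (s, t); rewrite /= sB tB s_up t_lo /= negb_forall.
  by case/existsP=> Z; rewrite !negb_imply => ?; exists Z.
exists W.
have upW : wsum x (B :&: W) = wsum up (B :&: W).
  apply: eq_wsum => s; rewrite inE => /andP[sB sW]; apply/eqP.
  have := disjointFr WN sW; rewrite inE sB /=.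
  by have := box s; lia.
have loW : wsum x (~: (B :|: W)) = wsum lo (~: (B :|: W)).
  apply: eq_wsum => t; rewrite !inE negb_or => /andP[tB tW'].
  have /contra/(_ tW') := subsetP DW t; rewrite inE tB /=.
  by have := box t; lia.
(* x(B) = x(B :&: W) + x(B :|: W) - x(W), and total 0 makes x(B :|: W) minus the sum over the
   complement. *)
have := wsumC x (B :|: W); have := wsumUI x B W; rewrite -upW -loW -tW; lia.
Qed.

(** Each exchange raises x(B) by one; getting stuck below [c] would exhibit a [W] whose bound equals
    x(B) < c. *)
Lemma boxed_cover_up x B (c : int) : boxed x -> covers x -> wsum x setT = 0 ->
    wsum x B <= c ->
    (forall W, c <= wsum up (B :&: W) - wsum lo (~: (B :|: W)) - q W) ->
  exists y, [/\ boxed y, covers y, wsum y setT = 0 & wsum y B = c].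
Proof.
move=> box cov xT le_c c_le.
have [n cE] : exists n : nat, c = wsum x B + n%:Z.
  by exists `|c - wsum x B|%N; lia.
elim: n x box cov xT {le_c} cE => [|n IHn] x box cov xT cE.
  by exists x; split=> //; lia.
have [[y [ybox ycov yT yB]]|[W xB]] := exchange_step B box cov xT.
  by apply: (IHn y) => //; lia.
by have := c_le W; lia.
Qed.

End Supermodular.

(** * Realizations of degree sequences *)

Section TopSets.
Variables (V : finType) (h : V -> int).
Implicit Types (K X Y : {set V}).

(** Take [K] of maximum weight among sets of this cardinality; swapping one element cannot increase
    the weight, so [K] is a top set. *)
Lemma top_set_dominates X :
  exists K, [/\ #|K| = #|X|, top_set h K & wsum h X <= wsum h K].
Proof.
have PX : #|X| == #|X| by [].
case: (@arg_maxP _ _ _ X (fun K : {set V} => #|K| == #|X|) (wsum h) PX) => K /eqP cK maxK.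
exists K; split=> //; last exact: maxK.
move=> x y xK yK; rewrite leNgt; apply/negP=> lt_h.
have yKx : y \notin K :\ x by rewrite inE (negbTE yK) andbF.
have := maxK (y |: (K :\ x)); rewrite /wsum big_setU1 // (big_setD1 x xK) /=.
rewrite cardsU1 yKx -cK [in #|K|](cardsD1 x K) xK eqxx => /(_ isT).
by rewrite lerD2r leNgt lt_h.
Qed.

Lemma top_set_card k : (k <= #|V|)%N -> exists2 K : {set V}, #|K| = k & top_set h K.
Proof.
move=> le_k; have [K [cK topK _]] := top_set_dominates [set v in take k (enum V)].
exists K => //; rewrite cK cardsE (card_uniqP _) ?take_uniq ?enum_uniq //.
by rewrite size_take_min -cardE; apply/minn_idPl.
Qed.

(* The maximum over Y is attained at the level set {v | j < h v}, and level sets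
   are comparable with the top set K. *)
Lemma top_set_decrement K (j : int) Y : top_set h K ->
  exists Y', wsum (fun v => h v - (v \in K)%:Z) Y - j * #|Y|%:Z
    <= wsum h Y' - (minn #|Y'| #|K|)%:Z - j * #|Y'|%:Z.
Proof.
move=> topK; pose h' v := h v - (v \in K)%:Z; pose L := [set v | j < h v].
exists L; have -> : minn #|L| #|K| = #|L :&: K|.
  have [LK|/subsetPn[y yL yK]] := boolP (L \subset K).
    by rewrite (setIidPl LK); apply/minn_idPl/subset_leq_card.
  suff KL : K \subset L by rewrite (setIidPr KL); apply/minn_idPr/subset_leq_card.
  apply/subsetP=> x xK; move: yL; rewrite !inE => /lt_le_trans; apply.
  exact: topK xK yK.
rewrite -wsum_mem -wsumB -/h' ![j * _]mulrC -!wsum_cst -!wsumB.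
rewrite (wsumID _ Y L) (wsumID _ L Y) setIC.
have le0 : wsum (fun v => h' v - j) (Y :\: L) <= wsum (fun=> 0) (Y :\: L).
  by apply: le_wsum => v; rewrite !inE /h' => /andP[? _]; lia.
have ge0 : wsum (fun=> 0) (L :\: Y) <= wsum (fun v => h' v - j) (L :\: Y).
  by apply: le_wsum => v; rewrite !inE /h' => /andP[_ ?]; case: (v \in K); lia.
by move: le0 ge0; rewrite !wsum_cst !mulr0; lia.
Qed.
End TopSets.

Lemma card_fiber (I : finType) (J : eqType) (f : I -> J) (E : {set I}) j :
  #|[set i in E | f i == j]| = (\sum_(i in E) (f i == j))%N.
Proof.
rewrite -sum1dep_card big_mkcondr; apply: eq_bigr => i _.
by case: (f i == j).
Qed.

(** * Gale-Ryser realization and switching *)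

Section Bipartite.
Variables (S T : finType).
Implicit Types (E F M : {set S * T}) (X A : {set S}) (Y : {set T}).

Lemma degS_sum E s : degS E s = (\sum_(e in E) (e.1 == s))%N.
Proof. exact: card_fiber. Qed.

Lemma degT_sum E t : degT E t = (\sum_(e in E) (e.2 == t))%N.
Proof. exact: card_fiber. Qed.

Lemma degS_row E s : degS E s = #|[set t | (s, t) \in E]|.
Proof.
have inj : injective (pair s : T -> S * T) by move=> ? ? [].
rewrite -(card_imset _ inj); apply: eq_card => -[s' t]; rewrite inE /=.
apply/andP/imsetP => [[stE /eqP ss]|[t' tE [-> ->]]]; last by rewrite inE in tE.
by exists t; rewrite ?inE -ss.
Qed.

Lemma degT_col E t : degT E t = #|[set s | (s, t) \in E]|.
Proof.
have inj : injective (pair^~ t : S -> S * T) by move=> ? ? [].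
rewrite -(card_imset _ inj); apply: eq_card => -[s t']; rewrite inE /=.
apply/andP/imsetP => [[stE /eqP tt]|[s' sE [-> ->]]]; last by rewrite inE in sE.
by exists s; rewrite ?inE -tt.
Qed.

(** Induction on the rows: join a row [s] to the [mS s] columns with the largest demands and realize
    the reduced demands on the other rows. *)
Lemma gale_ryser_on A (mS : S -> int) (mT : T -> int) :
    wsum mT setT = wsum mS A ->
    (forall X Y, X \subset A ->
       wsum mS X + wsum mT Y - #|X|%:Z * #|Y|%:Z <= wsum mS A) ->
  exists E, [/\ {in E, forall e, e.1 \in A},
                {in A, forall s, (degS E s)%:Z = mS s}
              & forall t, (degT E t)%:Z = mT t].
Proof.
move: {2}#|A| (erefl #|A|) => n cA; elim: n A cA mT => [|n IHn] A cA mT mST cond.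
  move/eqP: cA; rewrite cards_eq0 => /eqP A0; subst A.
  exists set0; split=> [e|s|t]; rewrite ?inE // degT_sum big_set0.
  (* With no rows the total demand is 0; the condition at [t] gives [mT t <= 0], and at the
     complement of [t] it gives [mT t >= 0]. *)
  have := cond set0 [set t] (sub0set _); have := cond set0 (~: [set t]) (sub0set _).
  by move: mST; rewrite (wsumC mT [set t]) !wsum0 wsum1 cards0; lia.
have [s sA] : exists s, s \in A by apply/card_gt0P; rewrite cA.
pose A' := A :\ s; have cA' : #|A'| = n by move: cA; rewrite (cardsD1 s) sA => -[].
have mA : wsum mS A = mS s + wsum mS A' by rewrite /wsum (big_setD1 s).
have mS0 : 0 <= mS s.
  by have := cond A' set0 (subsetDl _ _); rewrite mA wsum0 cards0; lia.
have le_T : (`|mS s| <= #|T|)%N.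
  have := cond [set s] setT; rewrite sub1set sA wsum1 cards1 mST cardsT.
  by move=> /(_ isT); lia.
have [K cK topK] := top_set_card mT le_T.
pose mT' t : int := mT t - (t \in K)%:Z.
have [|X Y XA'|E [EA' dS dT]] := IHn A' cA' mT'.
- by rewrite wsumB wsum_mem mST mA setTI cK; lia.
(* If the minimum in [le_Y] is [#|Y'|], the condition at [s |: X] suffices; if it is [mS s], the
   condition at [X] does. *)
- have [Y' le_Y] := top_set_decrement #|X|%:Z Y topK.
  have sX : s \notin X by apply/negP=> /(subsetP XA'); rewrite !inE eqxx.
  have XA : X \subset A := subset_trans XA' (subsetDl _ _).
  have := cond X Y' XA; have := cond (s |: X) Y'.
  rewrite subUset sub1set sA XA => /(_ isT).
  have -> : wsum mS (s |: X) = mS s + wsum mS X by rewrite /wsum big_setU1.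
  rewrite cardsU1 sX PoszD mulrDl mul1r mA; move: le_Y; rewrite cK -/mT'.
  by case: leqP; lia.
exists [set e | if e.1 == s then e.2 \in K else e \in E]; split.
- move=> e; rewrite inE; case: eqP => [->//|_ /EA']; rewrite inE.
  by case/andP.
- move=> x xA; rewrite degS_row; case: (eqVneq x s) => [->|xs].
    rewrite (_ : [set t | _] = K) ?cK ?gez0_abs //.
    by apply/setP=> t; rewrite !inE eqxx.
  rewrite -dS ?inE ?xs // degS_row; congr (Posz #|pred_of_set _|).
  by apply/setP=> t; rewrite !inE (negbTE xs).
move=> t; apply/eqP; rewrite -subr_eq0 -[mT t](subrK (t \in K)%:Z) -/(mT' t) -dT.
rewrite !degT_col (cardsD1 s) !inE eqxx.
rewrite (_ : _ :\ s = [set x | (x, t) \in E]) ?PoszD /=.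
  by rewrite [X in X - _]addrC subrr.
apply/setP=> x; rewrite !inE /=; case: eqP => //= ->.
by apply/esym/negbTE/negP=> /EA'; rewrite !inE eqxx.
Qed.

Definition same_degrees E F :=
  (forall s, degS E s = degS F s) /\ (forall t, degT E t = degT F t).

Definition switch E s t s' t' :=
  (s, t') |: ((s', t) |: (E :\ (s, t) :\ (s', t'))).

Lemma switch_degrees E s t s' t' : s != s' ->
    (s, t) \in E -> (s', t') \in E -> (s, t') \notin E -> (s', t) \notin E ->
  same_degrees (switch E s t s' t') E.
Proof.
move=> ss st st' nst nst'.
have tt : t != t' by apply: contraNneq nst => <-.
have in2 : (s', t') \in E :\ (s, t).
  by rewrite in_setD1 st' andbT xpair_eqE negb_and eq_sym ss.
have nin1 : (s', t) \notin E :\ (s, t) :\ (s', t') by rewrite !inE (negbTE nst') !andbF.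
have nin2 : (s, t') \notin (s', t) |: (E :\ (s, t) :\ (s', t')).
  by rewrite !inE (negbTE nst) !andbF orbF xpair_eqE negb_and ss.
split=> v; rewrite ?degS_sum ?degT_sum !big_setU1 //= (big_setD1 (s, t) st).
  by rewrite (big_setD1 (s', t') in2).
by rewrite (big_setD1 (s', t') in2) /= !addnA [X in (X + _)%N]addnC.
Qed.

Lemma degS_diff E F s :
  (degS E s + degS (F :\: E) s = degS F s + degS (E :\: F) s)%N.
Proof.
rewrite !degS_sum [X in (X + _)%N](big_setID F) [X in _ = (X + _)%N](big_setID E).
by rewrite /= setIC addnAC.
Qed.

Lemma degT_diff E F t :
  (degT E t + degT (F :\: E) t = degT F t + degT (E :\: F) t)%N.
Proof.
rewrite !degT_sum [X in (X + _)%N](big_setID F) [X in _ = (X + _)%N](big_setID E).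
by rewrite /= setIC addnAC.
Qed.

Lemma degS_gt0P E s : reflect (exists t, (s, t) \in E) (0 < degS E s)%N.
Proof.
rewrite degS_row; apply: (iffP card_gt0P) => -[t];
by [rewrite inE; exists t|exists t; rewrite inE].
Qed.

Lemma degT_gt0P E t : reflect (exists s, (s, t) \in E) (0 < degT E t)%N.
Proof.
rewrite degT_col; apply: (iffP card_gt0P) => -[s];
by [rewrite inE; exists s|exists s; rewrite inE].
Qed.

(* Call E1 - E2 red and E2 - E1 blue; choose a blue edge (s, t) with maximal red
   degree at s.  Unless a switch in E1 or E2 applies, for any red (s', t) all red
   neighbours of s, and t, are red neighbours of s'; then s' has red degree at
   least 2, hence a blue edge, contradicting maximality. *)
Lemma nested_realizations E1 E2 :
    (forall s, (degS E2 s <= degS E1 s <= (degS E2 s).+1)%N) ->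
    (forall t, (degT E2 t <= degT E1 t <= (degT E2 t).+1)%N) ->
  exists F1 F2, [/\ F2 \subset F1, same_degrees F1 E1 & same_degrees F2 E2].
Proof.
move: {2}#|E2 :\: E1|.+1 (ltnSn #|E2 :\: E1|) => n.
elim: n E1 E2 => // n IHn E1 E2; rewrite ltnS => lt_n dS dT.
have [E21|] := boolP (E2 \subset E1); first by exists E1, E2.
have IH E1' E2' : same_degrees E1' E1 -> same_degrees E2' E2 ->
    E2' :\: E1' \proper E2 :\: E1 ->
    exists F1 F2, [/\ F2 \subset F1, same_degrees F1 E1 & same_degrees F2 E2].
  move=> [S1 T1] [S2 T2] /proper_card lt_E.
  have [||t|F1 [F2 [F21 [F1S F1T] [F2S F2T]]]] := IHn E1' E2'.
  - exact: leq_trans lt_E lt_n.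
  - by move=> s; rewrite S1 S2.
  - by rewrite T1 T2.
  by exists F1, F2; split=> //; split=> v; rewrite ?F1S ?F1T ?F2S ?F2T.
case/subsetPn=> e eE2 eE1.
have eB : e \in E2 :\: E1 by rewrite inE eE1.
have [[s t] stB max_s] := @arg_maxnP _ e (fun e => e \in E2 :\: E1)
  (fun e => degS (E1 :\: E2) e.1) eB.
move: (stB); rewrite inE => /andP[st1 st2].
(* Degrees in [E1] are at least those in [E2], so a vertex on a blue edge is also on a red one. *)
have [t' st'R] : exists t', (s, t') \in E1 :\: E2.
  apply/degS_gt0P; have : (0 < degS (E2 :\: E1) s)%N by apply/degS_gt0P; exists t.
  by have := degS_diff E1 E2 s; have := dS s; lia.
have [s' s'tR] : exists s', (s', t) \in E1 :\: E2.
  apply/degT_gt0P; have : (0 < degT (E2 :\: E1) t)%N by apply/degT_gt0P; exists s.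
  by have := degT_diff E1 E2 t; have := dT t; lia.
have ss : s != s' by apply: contraNneq st1 => ->; case/setDP: s'tR.
case: (pickP [pred t1 | ((s, t1) \in E1 :\: E2) && ((s', t1) \notin E1 :\: E2)]).
  move=> t1 /= /andP[]; rewrite !inE in s'tR *.
  case/andP: s'tR => s't2 s't1 /andP[st12 st11].
  (* If (s', t1) is in [E1] then, not being red, it is also in [E2]: switching [E2] removes the blue
     edge (s, t) and adds only edges of [E1]. Otherwise, switching [E1] adds (s, t) and drops only
     red edges. Either way the blue set shrinks. *)
  have [s't11|s't11] := boolP ((s', t1) \in E1).
    rewrite andbT negbK => s't12.
    apply: (IH E1 (switch E2 s t s' t1)); [by split|exact: switch_degrees|].
    apply/properP; split; last first.
      exists (s, t) => //; rewrite !inE eqxx /= !xpair_eqE (negbTE ss) eqxx /=.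
      by rewrite orbF st1; apply: contraNneq st12 => <-.
    apply/subsetP=> x; rewrite !inE => /andP[xE1]; rewrite xE1.
    by case/or3P=> [/eqP xE|/eqP xE|/and3P[]//]; rewrite xE ?st11 ?s't1 in xE1.
  move=> _; apply: (IH (switch E1 s t1 s' t) E2); [exact: switch_degrees|by split|].
  apply/properP; split; last by exists (s, t) => //; rewrite !inE eqxx.
  apply/subsetP=> x; rewrite !inE !negb_or => /andP[/and3P[_ _ xE1] xE2].
  rewrite xE2 andbT; apply: contra xE1 => ->; rewrite andbT.
  by apply/andP; split; apply: contraTneq xE2 => ->.
move=> sub.
have lt_red : (degS (E1 :\: E2) s < degS (E1 :\: E2) s')%N.
  rewrite !degS_row; apply: proper_card; apply/properP; split.
    by apply/subsetP=> t1; have := sub t1; rewrite !inE /=; do 4 case: (_ \in _).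
  by exists t; rewrite inE // inE st2.
(* Red minus blue degree is at most 1, while the red degree of [s'] is at least 2. *)
have [t2 s't2] : exists t2, (s', t2) \in E2 :\: E1.
  apply/degS_gt0P; have : (0 < degS (E1 :\: E2) s)%N by apply/degS_gt0P; exists t'.
  by have := degS_diff E1 E2 s'; have := dS s'; lia.
by have := max_s _ s't2; rewrite /= leqNgt lt_red.
Qed.

Lemma degrees_le1_matching E M : M \subset E ->
  (forall s, (degS M s <= 1)%N) -> (forall t, (degT M t <= 1)%N) -> matching E M.
Proof.
move=> ME dS dT; apply/andP; split=> //.
apply/forall_inP=> e1 e1M; apply/forall_inP=> e2 e2M; apply/implyP=> ne.
apply/andP; split; apply: contraNneq ne => eq_e.
  by apply/eqP; apply: (card_le1_eqP (dS e1.1)); rewrite inE ?e1M ?e2M ?eq_e /=.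
by apply/eqP; apply: (card_le1_eqP (dT e1.2)); rewrite inE ?e1M ?e2M ?eq_e /=.
Qed.

End Bipartite.

(** * Block counts of edges and realizations with a large matching *)

Section Counting.
Variables (S T : finType).
Implicit Types (E F M : {set S * T}) (X A : {set S}) (Y : {set T}).

Definition edges_between E X Y := #|[set e in E | (e.1 \in X) && (e.2 \in Y)]|.

Lemma wsum_card_fiber (I J : finType) (f : I -> J) (E : {set I}) (D : {set J}) :
  wsum (fun j => #|[set i in E | f i == j]|%:Z) D = #|[set i in E | f i \in D]|%:Z.
Proof.
rewrite /wsum -(big_morph Posz PoszD (erefl _)) -sum1dep_card; congr Posz.
rewrite (partition_big f (mem D)) /=; last by move=> i /andP[].
apply: eq_bigr => j jD; rewrite -sum1dep_card; apply: eq_bigl => i.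
by case: eqP => [->|_]; rewrite ?andbF ?jD ?andbT.
Qed.

Lemma wsum_degS E X Y :
  wsum (fun s => (degS E s)%:Z) X = (edges_between E X Y + edges_between E X (~: Y))%:Z.
Proof.
rewrite wsum_card_fiber -(cardsID [set e | e.2 \in Y]); congr (Posz (_ + _)%N);
by apply: eq_card => e; rewrite !inE -?andbA // andbC -andbA.
Qed.

Lemma wsum_degT E X Y :
  wsum (fun t => (degT E t)%:Z) Y = (edges_between E X Y + edges_between E (~: X) Y)%:Z.
Proof.
rewrite wsum_card_fiber -(cardsID [set e | e.1 \in X]); congr (Posz (_ + _)%N);
by apply: eq_card => e; rewrite !inE;
   case: (e \in E); case: (e.1 \in X); case: (e.2 \in Y).
Qed.

Lemma wsum_degS_setT E : wsum (fun s => (degS E s)%:Z) setT = #|E|%:Z.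
Proof.
by rewrite wsum_card_fiber; congr Posz; apply: eq_card => e; rewrite !inE andbT.
Qed.

Lemma edges_between_le E X Y : (edges_between E X Y <= #|X| * #|Y|)%N.
Proof.
rewrite -cardsX; apply/subset_leq_card/subsetP=> e.
by rewrite !inE => /andP[].
Qed.

Lemma card_le_image (I J : finType) (f : I -> J) (M : {set I}) (D : {set J}) :
  {in M &, injective f} -> (#|[set i in M | f i \in D]| <= #|D|)%N.
Proof.
move=> inj; rewrite -(card_in_imset (f := f)); last first.
  by move=> i j /setIdP[iM _] /setIdP[jM _]; apply: inj.
by apply/subset_leq_card/subsetP=> _ /imsetP[i /setIdP[_ iD] ->].
Qed.

(** Weak König duality: a matching has at most [#|X|] edges meeting [X], at most [#|Y|] others
    meeting [Y], and the rest avoid both. *)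
Lemma matching_number_le E X Y :
  (matching_number E <= #|X| + #|Y| + edges_between E (~: X) (~: Y))%N.
Proof.
apply/bigmax_leqP=> M /andP[ME /forall_inP sep].
have inj1 : {in M &, injective (fst : S * T -> S)}.
  move=> e1 e2 e1M e2M eq_e; apply/eqP; apply: contraT => ne.
  by have /forall_inP/(_ e2 e2M) := sep e1 e1M; rewrite ne eq_e eqxx.
have inj2 : {in M &, injective (snd : S * T -> T)}.
  move=> e1 e2 e1M e2M eq_e; apply/eqP; apply: contraT => ne.
  by have /forall_inP/(_ e2 e2M) := sep e1 e1M; rewrite ne eq_e eqxx andbF.
rewrite -(cardsID [set e | e.1 \in X]) -addnA.
apply: leq_add.
  by apply: leq_trans (card_le_image X inj1); rewrite setIdE.
rewrite -(cardsID [set e | e.2 \in Y]); apply: leq_add.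
  apply: leq_trans (card_le_image Y inj2); apply/subset_leq_card/subsetP=> e.
  by rewrite !inE => /andP[/andP[_ ->] ->].
apply/subset_leq_card/subsetP=> e; rewrite !inE => /andP[-> /andP[-> eM]].
by rewrite (subsetP ME).
Qed.

Lemma admissible_bounds l fS gS fT gT E X Y : admissible l fS gS fT gT E ->
  [/\ wsum fS X <= wsum (fun s => (degS E s)%:Z) X,
      wsum (fun s => (degS E s)%:Z) (~: X) <= wsum gS (~: X),
      wsum fT Y <= wsum (fun t => (degT E t)%:Z) Y,
      wsum (fun t => (degT E t)%:Z) (~: Y) <= wsum gT (~: Y)
    & pospart (l - #|X|%:Z - #|Y|%:Z) <= (edges_between E (~: X) (~: Y))%:Z].
Proof.
case=> le_l dS dT; split.
- by apply: le_wsum => s _; case/andP: (dS s).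
- by apply: le_wsum => s _; case/andP: (dS s).
- by apply: le_wsum => t _; case/andP: (dT t).
- by apply: le_wsum => t _; case/andP: (dT t).
- by have := matching_number_le E X Y; rewrite /pospart; lia.
Qed.

Lemma realization_with_matching (n : nat) (mS : S -> int) (mT : T -> int) (c : int) :
    (n <= #|S|)%N -> (n <= #|T|)%N -> wsum mS setT = c -> wsum mT setT = c ->
    (forall X Y, wsum mS X + wsum mT Y - #|X|%:Z * #|Y|%:Z
       + (n - #|X| - #|Y|)%N%:Z <= c) ->
  exists E, [/\ (n <= matching_number E)%N, forall s, (degS E s)%:Z = mS s
    & forall t, (degT E t)%:Z = mT t].
Proof.
move=> nS nT mSc mTc cond.
have [S' cS' topS] := top_set_card mS nS.
have [T' cT' topT] := top_set_card mT nT.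
pose mS' s : int := mS s - (s \in S')%:Z; pose mT' t : int := mT t - (t \in T')%:Z.
have mS'c : wsum mS' setT = c - n%:Z by rewrite wsumB wsum_mem setTI cS' mSc.
have mT'c : wsum mT' setT = c - n%:Z by rewrite wsumB wsum_mem setTI cT' mTc.
have [||E1 [_ dS1 dT1]] := @gale_ryser_on _ _ setT mS mT.
- by rewrite mSc.
- by move=> X Y _; have := cond X Y; rewrite mSc; lia.
have [||E2 [_ dS2 dT2]] := @gale_ryser_on _ _ setT mS' mT'.
- by rewrite mS'c.
(* Replace [X] with [Y] fixed, then [Y] with [X'] fixed; the claim follows from min(x,n) + min(y,n)
   + (n-x-y)^+ >= n. *)
- move=> X Y _; have [X' le_X] := top_set_decrement #|Y|%:Z X topS.
  have [Y' le_Y] := top_set_decrement #|X'|%:Z Y topT.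
  have := cond X' Y'; move: le_X le_Y; rewrite cS' cT' -/mS' -/mT' mS'c.
  rewrite ![#|Y|%:Z * _]mulrC; case: (leqP #|X'| n); case: (leqP #|Y'| n); lia.
have [s|t|F1 [F2 [F21 [S1 T1] [S2 T2]]]] := @nested_realizations _ _ E1 E2.
- have := dS1 s; have := dS2 s; rewrite inE /mS'.
  by move=> /(_ isT) + /(_ isT); case: (s \in S'); lia.
- by have := dT1 t; have := dT2 t; rewrite /mT'; case: (t \in T'); lia.
have F0 : F2 :\: F1 = set0 by apply/eqP; rewrite setD_eq0.
have dF0 s : degS (F2 :\: F1) s = 0%N by rewrite F0 degS_sum big_set0.
have dF0' t : degT (F2 :\: F1) t = 0%N by rewrite F0 degT_sum big_set0.
exists F1; split=> [|s|t]; last 2 first.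
- by rewrite S1 dS1.
- by rewrite T1.
(* The difference has [n] edges, and the degrees drop by at most one everywhere, so it is a
   matching. *)
apply: (@leq_trans #|F1 :\: F2|).
  have := cardsID F2 F1; rewrite (setIidPr F21).
  have : #|F1|%:Z = wsum mS setT.
    by rewrite -wsum_degS_setT; apply: eq_wsum => s _; rewrite S1 dS1.
  have : #|F2|%:Z = wsum mS' setT.
    by rewrite -wsum_degS_setT; apply: eq_wsum => s _; rewrite S2 dS2.
  by rewrite mS'c mSc; lia.
apply: (@leq_bigmax_cond _ _ (fun M : {set S * T} => #|M|)).
apply: degrees_le1_matching; first exact: subsetDl.
  move=> s; have := degS_diff F1 F2 s; rewrite dF0 S1 S2.
  have := dS1 s; have := dS2 s; rewrite inE /mS'.
  by move=> /(_ isT) + /(_ isT); case: (s \in S'); lia.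
move=> t; have := degT_diff F1 F2 t; rewrite dF0' T1 T2.
by have := dT1 t; have := dT2 t; rewrite /mT'; case: (t \in T'); lia.
Qed.

End Counting.

(** * Degree bounds and number of edges *)

Section Realization.
Variables (S T : finType) (l : int).
Implicit Types (E : {set S * T}) (X : {set S}) (Y : {set T}) (Z W : {set S + T}).

Definition lpart Z : {set S} := inl @^-1: Z.
Definition rpart Z : {set T} := inr @^-1: Z.

Definition sumfun (mS : S -> int) (mT : T -> int) (v : S + T) : int :=
  match v with inl s => mS s | inr t => mT t end.

Definition deficiency X Y : int :=
  pospart (l - #|X|%:Z - #|Y|%:Z) - #|X|%:Z * #|Y|%:Z.

Lemma wsum_sum (x : S + T -> int) Z :
  wsum x Z = wsum (x \o inl) (lpart Z) + wsum (x \o inr) (rpart Z).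
Proof.
rewrite /wsum big_mkcond big_sumType /= [in RHS]big_mkcond /=; congr (_ + _).
  by apply: eq_bigr => s _; rewrite inE.
by rewrite [RHS]big_mkcond; apply: eq_bigr => s _; rewrite inE.
Qed.

(** Because [X] is complemented, unions pair with intersections across the two sides, and the
    product term gains |X1-X2| |Y1-Y2| + |X2-X1| |Y2-Y1|. *)
Lemma deficiency_supermodular :
  supermodular (fun Z => deficiency (~: lpart Z) (rpart Z)).
Proof.
move=> Z W /=.
have -> : lpart (Z :|: W) = lpart Z :|: lpart W by rewrite /lpart preimsetU.
have -> : rpart (Z :|: W) = rpart Z :|: rpart W by rewrite /rpart preimsetU.
have -> : lpart (Z :&: W) = lpart Z :&: lpart W by rewrite /lpart preimsetI.
have -> : rpart (Z :&: W) = rpart Z :&: rpart W by rewrite /rpart preimsetI.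
rewrite setCU setCI.
move: (~: lpart Z) (~: lpart W) (rpart Z) (rpart W) => X1 X2 Y1 Y2.
have := cardsUI X1 X2; have := cardsUI Y1 Y2.
have := subset_leq_card (subsetIl X1 X2); have := subset_leq_card (subsetIr X1 X2).
have := subset_leq_card (subsetIl Y1 Y2); have := subset_leq_card (subsetIr Y1 Y2).
rewrite /deficiency.
move: #|X1 :|: X2| #|X1 :&: X2| #|Y1 :|: Y2| #|Y1 :&: Y2| #|X1| #|X2| #|Y1| #|Y2|.
move=> xu xi yu yi x1 x2 y1 y2 y2i y1i x2i x1i yE xE.
pose p := (x1 - xi)%N; pose r := (x2 - xi)%N.
pose p' := (y1 - yi)%N; pose r' := (y2 - yi)%N.
have -> : x1 = (xi + p)%N by lia.
have -> : x2 = (xi + r)%N by lia.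
have -> : y1 = (yi + p')%N by lia.
have -> : y2 = (yi + r')%N by lia.
have -> : xu = (xi + p + r)%N by lia.
have -> : yu = (yi + p' + r')%N by lia.
clearbody p r p' r'.
(* The positive part breaks supermodularity by at most minn p p' or minn r r',
   which the term - |X| |Y| makes up for. *)
have min_mul m n : (minn m n <= m * n)%N.
  by case: m n => [|m] [|n] //; have := leq_pmulr m.+1 (ltn0Sn n); lia.
have := min_mul p p'; have := min_mul r r'; rewrite /pospart; clear.
rewrite !PoszD !(mulrDl, mulrDr) -!PoszM !(mulnC _ yi).
lia.
Qed.

Variables (fS gS : S -> int) (fT gT : T -> int).
Hypotheses (fgS : forall s, fS s <= gS s) (fgT : forall t, fT t <= gT t).

Let q Z := deficiency (~: lpart Z) (rpart Z).
(** Coordinates on [T] are negated degrees, so there [gT] bounds from below and [fT] from above; the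
    sum over [B] counts edges. *)
Let lo := sumfun fS (fun t => - gT t).
Let up := sumfun gS (fun t => - fT t).
Let B : {set S + T} := [set v | if v is inl _ then true else false].

Lemma realize_cover x : l <= #|S|%:Z -> l <= #|T|%:Z -> boxed lo up x -> covers q x ->
    wsum x setT = 0 ->
  exists E, admissible l fS gS fT gT E /\ #|E|%:Z = wsum x B.
Proof.
move=> lS lT box cov xT.
pose mS s := x (inl s); pose mT t := - x (inr t).
have xE Z : wsum x Z = wsum mS (lpart Z) - wsum mT (rpart Z).
  rewrite wsum_sum; congr (_ + _); rewrite /wsum -sumrN.
  by apply: eq_bigr => t _; rewrite /mT opprK.
have lB : lpart B = setT by apply/setP=> s; rewrite !inE.
have rB : rpart B = set0 by apply/setP=> t; rewrite !inE.
have mTS : wsum mT setT = wsum mS setT.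
  have := xE setT; rewrite xT /lpart /rpart !preimsetT; lia.
(* [l] may be negative, hence the size max(l, 0) for the matching. *)
have [||X Y|E [nE dS dT]] :=
  @realization_with_matching S T `|Num.max l 0|%N mS mT _ _ _ (erefl _) mTS.
- lia.
- lia.
- pose Z : {set S + T} :=
    [set v | match v with inl s => s \notin X | inr t => t \in Y end].
  have lZ : lpart Z = ~: X by apply/setP=> s; rewrite !inE.
  have rZ : rpart Z = Y by apply/setP=> t; rewrite !inE.
  have := cov Z; rewrite xE /q lZ rZ setCK /deficiency /pospart.
  have := wsumC mS X; lia.
exists E; split; last first.
  rewrite -wsum_degS_setT xE lB rB wsum0 subr0.
  by apply: eq_wsum => s _; rewrite dS.
split=> [|s|t]; first by lia.
  by rewrite dS; exact: (box (inl s)).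
by have := box (inr t); rewrite dT /= /mT; lia.
Qed.

Hypotheses (lS : l <= #|S|%:Z) (lT : l <= #|T|%:Z).

(** The empty set encodes X = S, Y empty, where the positive part vanishes since [l <= |S|]; dually
    [qT] uses [l <= |T|]. *)
Let q0 : q set0 = 0.
Proof.
rewrite /q /deficiency /lpart /rpart !preimset0 setC0 cardsT cards0 /pospart; lia.
Qed.

Let qT : q setT = 0.
Proof.
rewrite /q /deficiency /lpart /rpart !preimsetT setCT cardsT cards0 /pospart; lia.
Qed.

Let lo_up v : lo v <= up v.
Proof. by case: v => [s|t] /=; rewrite ?lerN2. Qed.

Let wsum_lo Z : wsum lo Z = wsum fS (lpart Z) - wsum gT (rpart Z).
Proof. by rewrite wsum_sum; congr (_ + _); rewrite /wsum -sumrN. Qed.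

Let wsum_up Z : wsum up Z = wsum gS (lpart Z) - wsum fT (rpart Z).
Proof. by rewrite wsum_sum; congr (_ + _); rewrite /wsum -sumrN. Qed.

Let lpartC Z : lpart (~: Z) = ~: lpart Z.
Proof. exact: preimsetC. Qed.

Let rpartC Z : rpart (~: Z) = ~: rpart Z.
Proof. exact: preimsetC. Qed.

(** The first inequality is the condition on [up] at the set encoding (X, Y), the second the
    condition on [lo]. *)
Lemma degree_bounded_cover :
    (forall X Y, wsum fT Y + deficiency X Y <= wsum gS (~: X) /\
                 wsum fS X + deficiency X Y <= wsum gT (~: Y)) ->
  exists x, [/\ boxed lo up x, covers q x & wsum x setT = 0].
Proof.
move=> cond; apply: boxed_cover_exists; rewrite ?q0 ?qT //.
- exact: deficiency_supermodular.
- move=> W; rewrite wsum_up.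
  by have [+ _] := cond (~: lpart W) (rpart W); rewrite setCK /q; lia.
- move=> W; rewrite wsum_lo lpartC rpartC.
  by have [_ +] := cond (~: lpart W) (rpart W); rewrite /q; lia.
Qed.

(** If x(B) is below [alpha], raise it to [alpha]; if above [beta], lower it to [beta]; the
    obstructions are exactly violations of (1) and (2). *)
Lemma cover_with_size x (alpha beta : int) : boxed lo up x -> covers q x ->
    wsum x setT = 0 -> alpha <= beta ->
    (forall X Y, alpha <= wsum gS (~: X) + wsum gT (~: Y) - deficiency X Y) ->
    (forall X Y, wsum fS X + wsum fT Y + deficiency X Y <= beta) ->
  exists y, [/\ boxed lo up y, covers q y, wsum y setT = 0
    & alpha <= wsum y B <= beta].
Proof.
move=> box cov xT ab lower upper.
have lB : lpart B = setT by apply/setP=> s; rewrite !inE.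
have rB : rpart B = set0 by apply/setP=> t; rewrite !inE.
have lI Z W : lpart (Z :&: W) = lpart Z :&: lpart W by exact: preimsetI.
have rI Z W : rpart (Z :&: W) = rpart Z :&: rpart W by exact: preimsetI.
have [lt_a|ge_a] := ltP (wsum x B) alpha.
  have [||W|y [ybox ycov yT yB]] :=
      boxed_cover_up (B := B) (c := alpha) _ q0 qT box cov xT.
  - exact: deficiency_supermodular.
  - exact: ltW.
  - rewrite wsum_lo wsum_up setCU.
    rewrite !lI !rI !lpartC !rpartC lB rB setTI set0I setCT set0I.
    rewrite setC0 setTI !wsum0; have := lower (~: lpart W) (rpart W).
    by rewrite setCK /q; lia.
  by exists y; rewrite yB lexx.
have [lt_b|ge_b] := ltP beta (wsum x B); last by exists x; rewrite ge_a.
(* Lowering x(B) to [beta] is raising the sum over [~: B] to [- beta], as the total is 0. *)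
have [||W|y [ybox ycov yT yB]] :=
    boxed_cover_up (B := ~: B) (c := - beta) _ q0 qT box cov xT.
- exact: deficiency_supermodular.
- have -> : wsum x (~: B) = - wsum x B.
    by apply/eqP; rewrite -addr_eq0 addrC -wsumC xT.
  by rewrite lerN2 ltW.
- rewrite wsum_lo wsum_up setCU setCK.
  rewrite !lI !rI !lpartC !rpartC lB rB setTI set0I setCT set0I.
  rewrite setC0 setTI !wsum0; have := upper (~: lpart W) (rpart W).
  by rewrite /q; lia.
have yB' : wsum y B = beta.
  by apply/eqP; rewrite -subr_eq0 -yB -wsumC yT.
by exists y; rewrite yB' ab lexx.
Qed.

End Realization.

(** Beyond cardinalities only the weights of the complements matter, and a top set of the same size
    minimizes these. *)
Lemma lower_edge_cond_top (S T : finType) l (gS : S -> int) (gT : T -> int) alpha :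
    (forall X Y, top_set gS X -> top_set gT Y -> lower_edge_cond l gS gT alpha X Y) ->
  forall X Y, lower_edge_cond l gS gT alpha X Y.
Proof.
move=> top X Y; have [X' [cX topX leX]] := top_set_dominates gS X.
have [Y' [cY topY leY]] := top_set_dominates gT Y.
have := top X' Y' topX topY; rewrite /lower_edge_cond cX cY.
have := wsumC gS X; have := wsumC gS X'; have := wsumC gT Y; have := wsumC gT Y'; lia.
Qed.

Lemma upper_edge_cond_top (S T : finType) l (fS : S -> int) (fT : T -> int) beta :
    (forall X Y, top_set fS X -> top_set fT Y -> upper_edge_cond l fS fT beta X Y) ->
  forall X Y, upper_edge_cond l fS fT beta X Y.
Proof.
move=> top X Y; have [X' [cX topX leX]] := top_set_dominates fS X.
have [Y' [cY topY leY]] := top_set_dominates fT Y.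
have := top X' Y' topX topY; rewrite /upper_edge_cond cX cY; lia.
Qed.

(** * Necessity of the inequalities by counting edges in blocks *)

Section Necessity.
Variables (S T : finType) (l : int) (fS gS : S -> int) (fT gT : T -> int).
Variable E : {set S * T}.
Hypothesis admE : admissible l fS gS fT gT E.
Implicit Types (X : {set S}) (Y : {set T}).

(** Of the edges at [Y], at most |X||Y| come from [X]; the others, with the edges from [~: X] to
    [~: Y] forced by the matching, are counted by degrees in [~: X]. *)
Lemma admissible_feasible X Y :
  wsum fT Y - #|X|%:Z * #|Y|%:Z + pospart (l - #|X|%:Z - #|Y|%:Z)
    <= wsum gS (~: X) /\
  wsum fS X - #|X|%:Z * #|Y|%:Z + pospart (l - #|X|%:Z - #|Y|%:Z)
    <= wsum gT (~: Y).
Proof.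
have [fSX gSX fTY gTY] := admissible_bounds X Y admE.
have := wsum_degS E X Y; have := wsum_degS E (~: X) Y.
have := wsum_degT E X Y; have := wsum_degT E X (~: Y).
have := edges_between_le E X Y; rewrite -PoszM; lia.
Qed.

(** Degrees over both complements count the block [~: X], [~: Y] twice, which pays for the positive
    part, and miss only the block [X], [Y]. *)
Lemma admissible_lower_edge_cond X Y : lower_edge_cond l gS gT #|E|%:Z X Y.
Proof.
have [fSX gSX fTY gTY] := admissible_bounds X Y admE.
have := wsum_degS E X Y; have := wsum_degS E (~: X) Y.
have := wsum_degT E X Y; have := wsum_degT E X (~: Y).
have := wsum_degS_setT E; rewrite (wsumC _ X) /lower_edge_cond.
have := edges_between_le E X Y; rewrite -PoszM; lia.
Qed.

(** Here the block [X], [Y] is counted twice and the block of the complements is missed. *)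
Lemma admissible_upper_edge_cond X Y : upper_edge_cond l fS fT #|E|%:Z X Y.
Proof.
have [fSX gSX fTY gTY] := admissible_bounds X Y admE.
have := wsum_degS E X Y; have := wsum_degS E (~: X) Y.
have := wsum_degT E X Y; have := wsum_degT E X (~: Y).
have := wsum_degS_setT E; rewrite (wsumC _ X) /upper_edge_cond.
have := edges_between_le E X Y; rewrite -PoszM; lia.
Qed.

End Necessity.

(** * Assembly of the equivalences *)

Theorem theorem28 (S T : finType) (l : int) (hl : l <= #|T|%:Z)
    (fS gS : S -> int) (fT gT : T -> int)
    (hS : forall s : S, 0 <= fS s <= gS s)
    (hT : forall t : T, 0 <= fT t <= gT t)
    (alpha beta : int) (halpha : 0 <= alpha) (hab : alpha <= beta) :
  (* the two forms of the standing assumption are equivalent *)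
  ((exists E : {set S * T}, admissible l fS gS fT gT E) <->
   (forall (X : {set S}) (Y : {set T}),
      wsum fT Y - #|X|%:Z * #|Y|%:Z + pospart (l - #|X|%:Z - #|Y|%:Z)
        <= wsum gS (~: X) /\
      wsum fS X - #|X|%:Z * #|Y|%:Z + pospart (l - #|X|%:Z - #|Y|%:Z)
        <= wsum gT (~: Y))) /\
  ((exists E : {set S * T}, admissible l fS gS fT gT E) ->
   [/\ (* (A) *)
       ((exists E : {set S * T},
           admissible l fS gS fT gT E /\ alpha <= #|E|%:Z) <->
        (forall (X : {set S}) (Y : {set T}),
           lower_edge_cond l gS gT alpha X Y)) /\
       ((forall (X : {set S}) (Y : {set T}),
           top_set gS X -> top_set gT Y -> lower_edge_cond l gS gT alpha X Y) ->
        (forall (X : {set S}) (Y : {set T}),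
           lower_edge_cond l gS gT alpha X Y)),
       (* (B) *)
       ((exists E : {set S * T},
           admissible l fS gS fT gT E /\ #|E|%:Z <= beta) <->
        (forall (X : {set S}) (Y : {set T}),
           upper_edge_cond l fS fT beta X Y)) /\
       ((forall (X : {set S}) (Y : {set T}),
           top_set fS X -> top_set fT Y -> upper_edge_cond l fS fT beta X Y) ->
        (forall (X : {set S}) (Y : {set T}),
           upper_edge_cond l fS fT beta X Y))
     & (* (AB) *)
       (exists E : {set S * T},
          admissible l fS gS fT gT E /\ alpha <= #|E|%:Z <= beta) <->
       ((forall (X : {set S}) (Y : {set T}),
           lower_edge_cond l gS gT alpha X Y) /\
        (forall (X : {set S}) (Y : {set T}),
           upper_edge_cond l fS fT beta X Y))]).
Proof.
have fgS s : fS s <= gS s by case/andP: (hS s).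
have fgT t : fT t <= gT t by case/andP: (hT t).
set feasible := forall X : {set S}, _.
(* Feasibility at X = S with Y empty bounds (l - |S|)^+ by an empty sum. *)
have le_S : feasible -> l <= #|S|%:Z.
  move=> /(_ setT set0)[+ _].
  by rewrite setCT !wsum0 cards0 cardsT /pospart; lia.
have cover : feasible -> forall X Y,
    wsum fT Y + deficiency l X Y <= wsum gS (~: X) /\
    wsum fS X + deficiency l X Y <= wsum gT (~: Y).
  by move=> feas X Y; have [] := feas X Y; rewrite /deficiency; lia.
have between (a b : int) : feasible -> a <= b ->
    (forall X Y, lower_edge_cond l gS gT a X Y) ->
    (forall X Y, upper_edge_cond l fS fT b X Y) ->
  exists E : {set S * T}, admissible l fS gS fT gT E /\ a <= #|E|%:Z <= b.
  move=> feas ab lower upper.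
  have [x [box cov xT]] := degree_bounded_cover fgS fgT (le_S feas) hl (cover feas).
  have [X Y|X Y|y [ybox ycov yT yB]] := cover_with_size (le_S feas) hl box cov xT ab.
  - by have := lower X Y; rewrite /lower_edge_cond /deficiency; lia.
  - by have := upper X Y; rewrite /upper_edge_cond /deficiency; lia.
  have [E [admE cE]] := realize_cover (le_S feas) hl ybox ycov yT.
  by exists E; rewrite cE.
split; [split|].
- by case=> E admE X Y; apply: admissible_feasible admE X Y.
- move=> feas.
  have [x [box cov xT]] := degree_bounded_cover fgS fgT (le_S feas) hl (cover feas).
  by have [E [admE _]] := realize_cover (le_S feas) hl box cov xT; exists E.
case=> E0 adm0; have feas : feasible by move=> X Y; apply: admissible_feasible adm0 X Y.
have lower E (a : int) X Y : admissible l fS gS fT gT E -> a <= #|E|%:Z ->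
    lower_edge_cond l gS gT a X Y.
  by move=> admE /le_trans; apply; apply: admissible_lower_edge_cond admE X Y.
have upper E (b : int) X Y : admissible l fS gS fT gT E -> #|E|%:Z <= b ->
    upper_edge_cond l fS fT b X Y.
  by move=> admE /(le_trans _); apply; apply: admissible_upper_edge_cond admE X Y.
split; [split|split|].
- split=> [[E [admE leE]] X Y|low]; first exact: lower admE leE.
  (* The given graph [E0] makes (2) hold for every bound from [#|E0|] upward; the maximum with
     [alpha] keeps the interval nonempty. *)
  have [||X Y|E [admE /andP[leE _]]] := between alpha (Num.max alpha #|E0|%:Z) feas.
  - by rewrite le_max lexx.
  - exact: low.
  - by apply: upper adm0 _; rewrite le_max lexx orbT.
  by exists E.
- exact: lower_edge_cond_top.
- split=> [[E [admE leE]] X Y|upp]; first exact: upper admE leE.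
  (* Dually, [E0] makes (1) hold for every bound up to [#|E0|]. *)
  have [|X Y||E [admE /andP[_ leE]]] := between (Num.min beta #|E0|%:Z) beta feas.
  - by rewrite ge_min lexx.
  - by apply: lower adm0 _; rewrite ge_min lexx orbT.
  - exact: upp.
  by exists E.
- exact: upper_edge_cond_top.
split=> [[E [admE /andP[leE Ele]]]|[low upp]]; last exact: between.
by split=> X Y; [apply: lower admE leE|apply: upper admE Ele].
Qed.
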